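(* Let $\Lambda:=(\mathcal{A}_1,\mathcal{A}_2,\ldots,\mathcal{A}_{m-1})\in \mathbb{T}_{m,n}\times \mathbb{T}_{m-1,n}\times\cdots\times\mathbb{T}_{2,n}$ and $b\in\mathbb{R}^n$, and define $F,G:\mathbb{R}^n\to\mathbb{R}^n$ by $$F(x)=\sum_{k=1}^{m-1}\mathcal{A}_kx^{m-k}-b,\qquad G(x)=\sum_{k=1}^{m-2}\mathcal{A}_kx^{m-k}-b .$$ Let $X:=\{x\in\mathbb{R}^n:F(x)=0\}$ and let $\bar x\in X$. Suppose that, on some neighborhood $N(\bar x,\mathbf{r})$ of $\bar x$, there is a constant $c_0>0$ such that $\|\mathcal{A}_{m-1}(x-\bar x)\|\ge c_0\|x-\bar x\|$ for any $x\in N(\bar x,\mathbf{r})$, and that $\|G(x)-G(\bar x)\|=o(\|x-\bar x\|)$ as $x\to\bar x$. Then $\|F(x)\|$ provides a local error bound for $F(x)=0$ on $N(\bar x,\mathbf{r})$; that is, there exists a constant $c>0$ such that $$\|F(x)\|\ge c\,{\rm dist}(x,X)\qquad\text{for any }x\in N(\bar x,\mathbf{r}).$$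
   Context: $\mathbb{T}_{l,n}$ denotes the set of all $l$-th order $n$-dimensional square real tensors $\mathcal{A}=(a_{i_1i_2\cdots i_l})$, $i_1,\ldots,i_l\in\{1,\ldots,n\}$ (so $\mathbb{T}_{2,n}$ is the set of real $n\times n$ matrices, and $\mathcal{A}_{m-1}$ is such a matrix). For $\mathcal{A}\in\mathbb{T}_{l,n}$ and $x\in\mathbb{R}^n$, $\mathcal{A}x^{l-1}\in\mathbb{R}^n$ is the vector with components $(\mathcal{A}x^{l-1})_i=\sum_{i_2,\ldots,i_l=1}^n a_{ii_2\cdots i_l}x_{i_2}\cdots x_{i_l}$. In particular $\mathcal{A}_k\in\mathbb{T}_{m-k+1,n}$ and $\mathcal{A}_kx^{m-k}\in\mathbb{R}^n$. The equation $F(x)=0$ is the generalized tensor equation $\mathcal{A}_1x^{m-1}+\mathcal{A}_2x^{m-2}+\cdots+\mathcal{A}_{m-1}x=b$. $N(\bar x,\mathbf{r})$ denotes a neighborhood of $\bar x$ (with radius $\mathbf{r}$), the same one in hypothesis and conclusion. $\|\cdot\|$ is the Euclidean norm and ${\rm dist}(x,X)=\inf_{y\in X}\|y-x\|$.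
   Formalization: The error bound is proved on some possibly smaller neighborhood of x̄, on which the lower bound on A_{m-1} also holds; on the given N(x̄,r) it can fail, e.g. F(x)=x(x-1)^2, x̄=0, r=2. *)

(* Defs.v *)
From HB Require Import structures.
From mathcomp Require Import all_boot all_order all_algebra.
From mathcomp Require Import all_classical all_reals all_analysis.

Set Implicit Arguments.
Unset Strict Implicit.
Unset Printing Implicit Defensive.

Import Order.TTheory GRing.Theory Num.Theory.
Import numFieldNormedType.Exports.

Local Open Scope classical_set_scope.
Local Open Scope ring_scope.

Definition tensor (R : realType) (l n : nat) := {ffun l.-tuple 'I_n -> R}.

(* For A of order d+1, the vector A x^d. *)
Definition tapply (R : realType) (d n : nat) (A : tensor R d.+1 n)
    (x : 'cV[R]_n) : 'cV[R]_n :=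
  \col_i \sum_(t : d.-tuple 'I_n)
    A [tuple of i :: t] * \prod_(j < d) x (tnth t j) 0.

(* The library norm on 'cV[R]_n is the maximum norm. *)
Definition enorm (R : realType) (n : nat) (x : 'cV[R]_n) : R :=
  Num.sqrt (\sum_i x i 0 ^+ 2).

Definition edist_to (R : realType) (n : nat) (x : 'cV[R]_n)
    (X : set 'cV[R]_n) : R :=
  inf [set enorm (y - x) | y in X].

Definition eball (R : realType) (n : nat) (xbar : 'cV[R]_n) (r : R) :
    set 'cV[R]_n :=
  [set x | enorm (x - xbar) < r].

(* [Lam k] is the tensor A_k, of order m - k + 1; the sums below only involve
   the indices 1 <= k <= m - 1, so the other members of the family are
   irrelevant. *)
Definition tensor_family (R : realType) (m n : nat) :=
  forall k : nat, tensor R (m - k).+1 n.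

Definition Fmap (R : realType) (m n : nat) (Lam : tensor_family R m n)
    (b x : 'cV[R]_n) : 'cV[R]_n :=
  \sum_(1 <= k < m) tapply (Lam k) x - b.

Definition Gmap (R : realType) (m n : nat) (Lam : tensor_family R m n)
    (b x : 'cV[R]_n) : 'cV[R]_n :=
  \sum_(1 <= k < m.-1) tapply (Lam k) x - b.

Definition solset (R : realType) (m n : nat) (Lam : tensor_family R m n)
    (b : 'cV[R]_n) : set 'cV[R]_n :=
  [set x | Fmap Lam b x = 0].

(* The exponent m - (m - 1) hidden in [tapply (Lam m.-1)] is 1: this is the
   matrix-vector product A_{m-1} (x - xbar). *)
Definition last_bounded_below (R : realType) (m n : nat)
    (Lam : tensor_family R m n) (xbar : 'cV[R]_n) (N : set 'cV[R]_n) : Prop :=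
  exists2 c0 : R, 0 < c0 &
    forall x, N x ->
      c0 * enorm (x - xbar) <= enorm (tapply (Lam m.-1) (x - xbar)).

Definition local_error_bound (R : realType) (m n : nat)
    (Lam : tensor_family R m n) (b : 'cV[R]_n) (N : set 'cV[R]_n) : Prop :=
  exists2 c : R, 0 < c &
    forall x, N x -> c * edist_to x (solset Lam b) <= enorm (Fmap Lam b x).

(* Main.v *)
Require Import Defs.
From mathcomp Require Import all_boot all_order all_algebra.
From mathcomp Require Import all_classical all_reals all_analysis.
From mathcomp Require Import lra.
Import Order.TTheory GRing.Theory Num.Theory.
Import numFieldNormedType.Exports.
Local Open Scope classical_set_scope.
Local Open Scope ring_scope.

(* Since F(xbar) = 0 and A_{m-1} is linear, F(x) = A_{m-1}(x - xbar) +
   (G(x) - G(xbar)). The first term has norm at least c0 |x - xbar|, and the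
   second at most (c0/2) |x - xbar| close to xbar, so |F(x)| is at least
   (c0/2) |x - xbar|, which dominates (c0/2) dist(x, X). The triangle inequality
   for the Euclidean norm is replaced by the cheaper
   |u + v|^2 >= |u|^2 / 2 - |v|^2, which already gives this constant. *)

Lemma enorm_ge0 {R : realType} {n : nat} (x : 'cV[R]_n) : 0 <= enorm x.
Proof. exact: sqrtr_ge0. Qed.

Lemma sqr_enorm {R : realType} {n : nat} (x : 'cV[R]_n) :
  enorm x ^+ 2 = \sum_i x i 0 ^+ 2.
Proof. by rewrite sqr_sqrtr // sumr_ge0 // => i _; exact: sqr_ge0. Qed.

Lemma enormN {R : realType} {n : nat} (x : 'cV[R]_n) : enorm (- x) = enorm x.
Proof. by congr Num.sqrt; apply: eq_bigr => i _; rewrite mxE sqrrN. Qed.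

Lemma coord_le_enorm {R : realType} {n : nat} (x : 'cV[R]_n) (i : 'I_n) :
  `|x i 0| <= enorm x.
Proof.
rewrite -(ler_pXn2r (n := 2)) ?nnegrE ?enorm_ge0 // sqr_enorm real_normK ?num_real //.
by rewrite (bigD1 i) //= lerDl sumr_ge0 // => j _; exact: sqr_ge0.
Qed.

(** In each coordinate the right side exceeds the left by [(x i 0 + 2 * y i 0) ^+ 2 / 2]. *)
Lemma sqr_enormD_ge {R : realType} {n : nat} (x y : 'cV[R]_n) :
  enorm x ^+ 2 / 2 - enorm y ^+ 2 <= enorm (x + y) ^+ 2.
Proof.
rewrite !sqr_enorm mulr_suml -sumrB; apply: ler_sum => i _.
rewrite mxE; have := sqr_ge0 (x i 0 + 2 * y i 0); nra.
Qed.

Lemma edist_to_le {R : realType} {n : nat} (x y : 'cV[R]_n) (X : set 'cV[R]_n) :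
  X y -> edist_to x X <= enorm (x - y).
Proof.
move=> Xy; rewrite -enormN opprB; apply: ge_inf; last by exists y.
by exists 0 => _ [z _ <-]; exact: enorm_ge0.
Qed.

(** The topology comes from the maximum norm, which the Euclidean norm dominates, so the same radius
    serves. *)
Lemma eball_nbhs {R : realType} {n : nat} (x : 'cV[R]_n) (P : set 'cV[R]_n) :
  nbhs x P -> exists2 r : R, 0 < r & eball x r `<=` P.
Proof.
move=> /nbhs_ballP[e /= e0 xP]; exists e => // y yx; apply: xP; split => // i j.
rewrite ord1 -ball_normE /ball_ /= distrC.
have := coord_le_enorm (y - x) i; rewrite !mxE => /le_lt_trans; exact.
Qed.

(** The equation [d = 1] is a hypothesis because the exponent [m - m.-1] equals 1 only
    propositionally. *)
Lemma tapplyB {R : realType} {d n : nat} (A : tensor R d.+1 n) (x y : 'cV[R]_n) :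
  d = 1%N -> tapply A (x - y) = tapply A x - tapply A y.
Proof.
move=> d1; subst d; apply/colP => i; rewrite !mxE -sumrB; apply: eq_bigr => t _.
by rewrite !big_ord1 !mxE mulrBr.
Qed.

(** [Gmap] is [Fmap] without the term [k = m.-1], which occurs in the sum once [2 <= m]; [b]
    cancels. *)
Lemma Fmap_split {R : realType} {m n : nat} (Lam : tensor_family R m n)
    (b x y : 'cV[R]_n) : (2 <= m)%N ->
  Fmap Lam b x - Fmap Lam b y =
    tapply (Lam m.-1) (x - y) + (Gmap Lam b x - Gmap Lam b y).
Proof.
case: m Lam => [|[|m]] // Lam _.
rewrite tapplyB; last exact: subSnn.
rewrite /Fmap /Gmap !(big_nat_recr m.+1) //=.
by rewrite ![_ + tapply _ _ - b]addrAC opprD addrACA addrC.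
Qed.

Theorem theorem4p2 (R : realType) (m n : nat) (hm : (2 <= m)%N)
    (Lam : tensor_family R m n) (b xbar : 'cV[R]_n)
    (hxbar : solset Lam b xbar)
    (hA : exists2 r : R, 0 < r & last_bounded_below Lam xbar (eball xbar r))
    (hG : (fun x : 'cV[R]_n => enorm (Gmap Lam b x - Gmap Lam b xbar) : R^o)
          =o_ (nbhs xbar) (fun x : 'cV[R]_n => enorm (x - xbar) : R^o)) :
  exists2 r : R, 0 < r &
    last_bounded_below Lam xbar (eball xbar r) /\
    local_error_bound Lam b (eball xbar r).
Proof.
case: hA => rA rA0 [c0 c00 hc0].
have c20 : 0 < c0 / 2 by rewrite divr_gt0.
(* The little-o bound is taken with epsilon equal to [c0 / 2]. *)
have /eqoP/(_ _ c20)/eball_nbhs[rG rG0 hrG] := hG.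
exists (Num.min rA rG); first by rewrite lt_min rA0.
split; first by exists c0 => // x; rewrite /eball /= lt_min => /andP[xA _]; exact: hc0.
exists (c0 / 2) => // x; rewrite /eball /= lt_min => /andP[xA xG].
have lower := hc0 x xA.
have upper : enorm (Gmap Lam b x - Gmap Lam b xbar) <= c0 / 2 * enorm (x - xbar).
  by have := hrG x xG; rewrite /= !ger0_norm ?enorm_ge0.
have dist : edist_to x (solset Lam b) <= enorm (x - xbar) by exact: edist_to_le.
apply: (le_trans (ler_wpM2l (ltW c20) dist)).
have FE := Fmap_split Lam b x xbar hm; rewrite [Fmap Lam b xbar]hxbar subr0 in FE.
(* Both sides are nonnegative, so their squares may be compared. *)
rewrite -(ler_pXn2r (n := 2)) ?nnegrE ?enorm_ge0 //; last first.
  by rewrite mulr_ge0 ?enorm_ge0 // ltW.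
rewrite FE; apply: le_trans (sqr_enormD_ge _ _).
have le1 : (c0 * enorm (x - xbar)) ^+ 2 <= enorm (tapply (Lam m.-1) (x - xbar)) ^+ 2.
  by rewrite ler_pXn2r // nnegrE ?enorm_ge0 // mulr_ge0 ?enorm_ge0 // ltW.
have le2 : enorm (Gmap Lam b x - Gmap Lam b xbar) ^+ 2 <= (c0 / 2 * enorm (x - xbar)) ^+ 2.
  by rewrite ler_pXn2r // nnegrE ?enorm_ge0 // mulr_ge0 ?enorm_ge0 // ltW.
(* The constants fit exactly: [c0 ^+ 2 / 2 - (c0 / 2) ^+ 2 = (c0 / 2) ^+ 2]. *)
move: le1 le2; rewrite !exprMn; set u := enorm (x - xbar) ^+ 2; nra.
Qed.
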